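(* Let $A$ be an associative commutative complex algebra, and let $\Psi : A \rightarrow A$ be an algebra automorphism. Then every non-zero two-sided ideal of the crossed product $A \rtimes_{\Psi} \mathbb{Z}$ has non-zero intersection with the commutant $A'$ of $A$ in $A \rtimes_{\Psi} \mathbb{Z}$.
   Context: Algebras are not assumed to be unital. For an associative commutative complex algebra $A$ and an algebra automorphism $\Psi : A \to A$, the crossed product $A \rtimes_{\Psi} \mathbb{Z}$ is the associative complex algebra of all functions $f:\mathbb{Z}\to A$ with $f(n)=0$ for all but finitely many $n$, with pointwise addition and scalar multiplication, and with multiplication given by twisted convolution $(f*g)(n)=\sum_{k\in\mathbb{Z}} f(k)\cdot \Psi^k(g(n-k))$, where $\Psi^k$ is the $k$-fold composition of $\Psi$ with itself ($k\in\mathbb{Z}$). Elements are written as finite formal sums $\sum_{n} f_n\delta^n$ with $f_n=f(n)\in A$, so that $(f_n\delta^n)*(g_m\delta^m)=f_n\cdot\Psi^n(g_m)\,\delta^{n+m}$. The algebra $A$ is identified with the abelian subalgebra $\{f_0\delta^0 : f_0\in A\}$. The commutant $A'$ is the set of all elements of $A \rtimes_{\Psi} \mathbb{Z}$ that commute with every element of $A$. *)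

(* Defs.v *)
From HB Require Import structures.
From mathcomp Require Import all_boot all_order all_algebra.
From mathcomp Require Import finmap classical_sets reals complex.

Set Implicit Arguments.
Unset Strict Implicit.
Unset Printing Implicit Defensive.

Import GRing.Theory.
Local Open Scope classical_set_scope.
Local Open Scope fset_scope.
Local Open Scope ring_scope.

(* The algebra structures of MathComp all have a unit, hence this hierarchy of
   associative, not necessarily unital algebras. *)
HB.mixin Record Lmodule_isNUAlgebra (K : comNzRingType) A
    of GRing.Lmodule K A := {
  amul : A -> A -> A;
  amulA : associative amul;
  amulDl : left_distributive amul +%R;
  amulDr : right_distributive amul +%R;
  amulZl : forall (c : K) (x y : A), amul (c *: x) y = c *: amul x y;
  amulZr : forall (c : K) (x y : A), amul x (c *: y) = c *: amul x y
}.

#[short(type="nuAlgType")]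
HB.structure Definition NUAlgebra (K : comNzRingType) :=
  {A of Lmodule_isNUAlgebra K A & GRing.Lmodule K A}.

HB.mixin Record NUAlgebra_isCommutative (K : comNzRingType) A
    of NUAlgebra K A := {
  amulC : commutative (amul : A -> A -> A)
}.

#[short(type="comNUAlgType")]
HB.structure Definition ComNUAlgebra (K : comNzRingType) :=
  {A of NUAlgebra_isCommutative K A & NUAlgebra K A}.

Notation "x ** y" := (amul x y) (at level 40, left associativity) : ring_scope.

Section NUAlgebraTheory.
Variables (K : comNzRingType) (B : nuAlgType K).
Implicit Types x y : B.

Lemma amul0r x : 0 ** x = 0.
Proof. by rewrite -{1}(scale0r (0 : B)) amulZl scale0r. Qed.

Lemma amulr0 x : x ** 0 = 0.
Proof. by rewrite -{1}(scale0r (0 : B)) amulZr scale0r. Qed.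

Lemma amul_suml (T : Type) (r : seq T) (F : T -> B) x :
  (\sum_(i <- r) F i) ** x = \sum_(i <- r) F i ** x.
Proof.
by elim/big_rec2: _ => [|i y1 y2 _ <-]; rewrite ?amul0r ?amulDl.
Qed.

Lemma amul_sumr (T : Type) (r : seq T) (F : T -> B) x :
  x ** (\sum_(i <- r) F i) = \sum_(i <- r) x ** F i.
Proof.
by elim/big_rec2: _ => [|i y1 y2 _ <-]; rewrite ?amulr0 ?amulDr.
Qed.

Record two_sided_ideal (I : set B) : Prop := TwoSidedIdeal {
  ideal0 : I 0;
  idealD : forall x y, I x -> I y -> I (x + y);
  idealZ : forall (c : K) x, I x -> I (c *: x);
  idealMl : forall b x, I x -> I (b ** x);
  idealMr : forall b x, I x -> I (x ** b)
}.

Definition commutant (S : set B) : set B :=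
  [set x | forall y, S y -> x ** y = y ** x]%classic.

End NUAlgebraTheory.

(* The inverse is stored as data, so that negative powers can be formed; it is
   determined by the underlying map. *)
Record algAut (K : comNzRingType) (A : nuAlgType K) := AlgAut {
  aut_fun :> {linear A -> A};
  aut_inv : A -> A;
  autM : {morph aut_fun : x y / x ** y};
  autK : cancel aut_fun aut_inv;
  autVK : cancel aut_inv aut_fun
}.

Definition aut_pow (K : comNzRingType) (A : nuAlgType K) (Psi : algAut A)
    (k : int) : A -> A :=
  match k with
  | Posz n => iter n Psi
  | Negz n => iter n.+1 (aut_inv Psi)
  end.

Section AutPow.
Variables (K : comNzRingType) (A : nuAlgType K) (Psi : algAut A).

Lemma aut_powS k x : aut_pow Psi (k + 1) x = Psi (aut_pow Psi k x).
Proof.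
case: k => [n|[|n]].
- by rewrite -PoszD addn1.
- by rewrite /= autVK.
- rewrite (_ : Negz n.+1 + 1 = Negz n); first by rewrite /= autVK.
  by rewrite !NegzE -(addn1 n.+1) PoszD opprD addrK.
Qed.

Lemma aut_powB k x : aut_pow Psi (k - 1) x = aut_inv Psi (aut_pow Psi k x).
Proof. by rewrite -{2}(subrK 1 k) aut_powS autK. Qed.

Lemma aut_powD i j x : aut_pow Psi (i + j) x = aut_pow Psi i (aut_pow Psi j x).
Proof.
elim/int_rec: i => [|n IH|n IH]; first by rewrite add0r.
- by rewrite -addn1 PoszD addrAC !aut_powS IH.
- by rewrite -addn1 PoszD opprD addrAC !aut_powB IH.
Qed.

Lemma aut_pow_linear k : linear (aut_pow Psi k).
Proof.
move=> c x y; elim/int_rec: k => [//|n IH|n IH].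
- by rewrite -addn1 PoszD !aut_powS IH linearP.
- rewrite -addn1 PoszD opprD !aut_powB IH.
  by apply: (can_inj (autK Psi)); rewrite linearP !autVK.
Qed.

HB.instance Definition _ k :=
  GRing.isLinear.Build K A A *:%R (aut_pow Psi k) (aut_pow_linear k).

Lemma aut_powM k : {morph aut_pow Psi k : x y / x ** y}.
Proof.
move=> x y; elim/int_rec: k => [//|n IH|n IH].
- by rewrite -addn1 PoszD !aut_powS IH autM.
- rewrite -addn1 PoszD opprD !aut_powB IH.
  by apply: (can_inj (autK Psi)); rewrite autM !autVK.
Qed.

End AutPow.

Definition crossprod (K : comNzRingType) (A : comNUAlgType K)
  (Psi : algAut A) : Type := {fsfun int -> A with 0}.

Section CrossedProduct.
Variables (K : comNzRingType) (A : comNUAlgType K) (Psi : algAut A).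
Local Notation CP := (crossprod Psi).
Implicit Types f g h : CP.

HB.instance Definition _ := Choice.copy CP {fsfun int -> A with 0}.

Definition cp_coef f (n : int) : A := fun_of_fsfun f n.

Lemma cp_coefP f g : cp_coef f =1 cp_coef g <-> f = g.
Proof. by split=> [fg|->//]; apply/fsfunP. Qed.

Definition cp_zero : CP := [fsfun].
Definition cp_add f g : CP :=
  [fsfun n in finsupp f `|` finsupp g => cp_coef f n + cp_coef g n].
Definition cp_opp f : CP := [fsfun n in finsupp f => - cp_coef f n].
Definition cp_scale (c : K) f : CP := [fsfun n in finsupp f => c *: cp_coef f n].

(* The sum over k restricts to the support of f, outside of which all terms
   vanish; for the same reason the product vanishes outside of
   finsupp f + finsupp g, see cp_mul_coef. *)
Definition cp_mul f g : CP :=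
  [fsfun n in [fset i + j | i in finsupp f, j in finsupp g] =>
     \sum_(k <- finsupp f) cp_coef f k ** aut_pow Psi k (cp_coef g (n - k))].

Lemma cp_dflt f n : n \notin finsupp f -> cp_coef f n = 0.
Proof. exact: fsfun_dflt. Qed.

Lemma cp_zero_coef n : cp_coef cp_zero n = 0.
Proof. exact: fsfun0E. Qed.

Lemma cp_add_coef f g n : cp_coef (cp_add f g) n = cp_coef f n + cp_coef g n.
Proof.
rewrite /cp_coef fsfunE inE; case: ifPn => // /norP[fn gn].
by rewrite !fsfun_dflt // addr0.
Qed.

Lemma cp_opp_coef f n : cp_coef (cp_opp f) n = - cp_coef f n.
Proof.
by rewrite /cp_coef fsfunE; case: ifPn => // fn; rewrite fsfun_dflt // oppr0.
Qed.

Lemma cp_scale_coef c f n : cp_coef (cp_scale c f) n = c *: cp_coef f n.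
Proof.
by rewrite /cp_coef fsfunE; case: ifPn => // fn; rewrite fsfun_dflt // scaler0.
Qed.

Lemma cp_mul_coef f g n : cp_coef (cp_mul f g) n =
  \sum_(k <- finsupp f) cp_coef f k ** aut_pow Psi k (cp_coef g (n - k)).
Proof.
rewrite {1}/cp_coef fsfunE; case: ifPn => // nfg.
rewrite big_seq big1 // => k kf.
rewrite (@cp_dflt g) ?linear0 ?amulr0 //.
apply: contra nfg => ng; apply/imfset2P; exists k => //.
by exists (n - k) => //; rewrite addrC subrK.
Qed.

Lemma cp_addA : associative cp_add.
Proof. by move=> f g h; apply/cp_coefP=> n; rewrite !cp_add_coef addrA. Qed.
Lemma cp_addC : commutative cp_add.
Proof. by move=> f g; apply/cp_coefP=> n; rewrite !cp_add_coef addrC. Qed.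
Lemma cp_add0 : left_id cp_zero cp_add.
Proof. by move=> f; apply/cp_coefP=> n; rewrite cp_add_coef cp_zero_coef add0r. Qed.
Lemma cp_addN : left_inverse cp_zero cp_opp cp_add.
Proof.
move=> f; apply/cp_coefP=> n.
by rewrite cp_add_coef cp_opp_coef cp_zero_coef addNr.
Qed.

HB.instance Definition _ :=
  GRing.isZmodule.Build CP cp_addA cp_addC cp_add0 cp_addN.

Lemma cp_scaleA a b f : cp_scale a (cp_scale b f) = cp_scale (a * b) f.
Proof. by apply/cp_coefP=> n; rewrite !cp_scale_coef scalerA. Qed.
Lemma cp_scale1 : left_id 1 cp_scale.
Proof. by move=> f; apply/cp_coefP=> n; rewrite cp_scale_coef scale1r. Qed.
Lemma cp_scaleDr : right_distributive cp_scale +%R.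
Proof.
move=> a f g; apply/cp_coefP=> n.
by rewrite cp_scale_coef !cp_add_coef !cp_scale_coef scalerDr.
Qed.
Lemma cp_scaleDl f : {morph cp_scale^~ f : a b / a + b}.
Proof.
move=> a b; apply/cp_coefP=> n.
by rewrite cp_scale_coef cp_add_coef !cp_scale_coef scalerDl.
Qed.

HB.instance Definition _ := GRing.Zmodule_isLmodule.Build K CP
  cp_scaleA cp_scale1 cp_scaleDr cp_scaleDl.

Lemma cp_mul_coef_sub (S : {fset int}) f g n : finsupp f `<=` S ->
  cp_coef (cp_mul f g) n =
  \sum_(k <- S) cp_coef f k ** aut_pow Psi k (cp_coef g (n - k)).
Proof.
move=> fS; rewrite cp_mul_coef; apply: big_fset_incl => // k kS kf.
by rewrite cp_dflt // amul0r.
Qed.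

Lemma cp_mulDl : left_distributive cp_mul +%R.
Proof.
move=> f g h; apply/cp_coefP=> n; rewrite cp_add_coef.
pose S := finsupp f `|` finsupp g `|` finsupp (f + g : CP).
rewrite !(@cp_mul_coef_sub S) ?(fsubsetUr _ _) //; first last.
- by rewrite /S -fsetUA fsubsetUl.
- by rewrite /S (fsetUC (finsupp f)) -fsetUA fsubsetUl.
rewrite -big_split /=; apply: eq_bigr => k _.
by rewrite cp_add_coef amulDl.
Qed.

Lemma cp_mulDr : right_distributive cp_mul +%R.
Proof.
move=> f g h; apply/cp_coefP=> n.
rewrite cp_add_coef !cp_mul_coef -big_split /=; apply: eq_bigr => k _.
by rewrite cp_add_coef linearD amulDr.
Qed.

Lemma cp_mulZl (c : K) f g : cp_mul (c *: f) g = c *: cp_mul f g.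
Proof.
apply/cp_coefP=> n; rewrite cp_scale_coef.
pose S := finsupp f `|` finsupp (c *: f : CP).
rewrite !(@cp_mul_coef_sub S) ?fsubsetUl ?fsubsetUr // scaler_sumr.
by apply: eq_bigr => k _; rewrite cp_scale_coef amulZl.
Qed.

Lemma cp_mulZr (c : K) f g : cp_mul f (c *: g) = c *: cp_mul f g.
Proof.
apply/cp_coefP=> n; rewrite cp_scale_coef !cp_mul_coef scaler_sumr.
by apply: eq_bigr => k _; rewrite cp_scale_coef linearZ /= amulZr.
Qed.

Lemma cp_mulA : associative cp_mul.
Proof.
move=> f g h; apply/cp_coefP=> n.
pose P := [fset i + j | i in finsupp f, j in finsupp g].
have sfg : finsupp (cp_mul f g) `<=` P by apply: finsupp_sub.
rewrite cp_mul_coef (cp_mul_coef_sub _ _ sfg).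
under [RHS]eq_bigr => k _ do rewrite cp_mul_coef amul_suml.
rewrite exchange_big /=; apply: eq_big_seq => i fi.
rewrite cp_mul_coef raddf_sum amul_sumr.
transitivity (\sum_(k <- [fset i + j | j in finsupp g])
   (cp_coef f i ** aut_pow Psi i (cp_coef g (k - i))) **
     aut_pow Psi k (cp_coef h (n - k))).
  rewrite big_imfset /=; last by move=> x y _ _; apply: addrI.
  apply: eq_bigr => j _; rewrite aut_powM amulA aut_powD opprD addrA.
  by rewrite (_ : i + j - i = j) // addrAC subrr add0r.
apply: big_fset_incl => [|k kP kg].
  by apply/fsubsetP=> _ /imfsetP[j jg ->]; apply: in_imfset2.
rewrite [cp_coef g _]cp_dflt ?linear0 ?amulr0 ?amul0r //.
apply: contra kg => kg; apply/imfsetP; exists (k - i) => //.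
by rewrite addrC subrK.
Qed.

HB.instance Definition _ := Lmodule_isNUAlgebra.Build K CP
  cp_mulA cp_mulDl cp_mulDr cp_mulZl cp_mulZr.

End CrossedProduct.

Definition cp_monom (K : comNzRingType) (A : comNUAlgType K) (Psi : algAut A)
  (a : A) (n : int) : crossprod Psi := [fsfun [fsfun] with n |-> a].

Lemma cp_monom_coef (K : comNzRingType) (A : comNUAlgType K) (Psi : algAut A)
    (a : A) (n m : int) :
  cp_coef (cp_monom Psi a n) m = if m == n then a else 0.
Proof. by rewrite /cp_coef fsfun_withE fsfun0E. Qed.

Lemma cp_monomM (K : comNzRingType) (A : comNUAlgType K) (Psi : algAut A)
    (a b : A) (n m : int) :
  cp_monom Psi a n ** cp_monom Psi b m =
  cp_monom Psi (a ** aut_pow Psi n b) (n + m).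
Proof.
apply/cp_coefP=> k; rewrite (@cp_mul_coef_sub _ _ _ [fset n]); last first.
  by rewrite finsupp_with; case: ifP => _; rewrite finsupp0 ?fsetU0 ?fset0D ?fsub0set.
rewrite big_seq_fset1 !cp_monom_coef eqxx subr_eq (addrC m).
by case: eqP; rewrite ?linear0 ?amulr0.
Qed.

Definition base_alg (K : comNzRingType) (A : comNUAlgType K) (Psi : algAut A) :
  set (crossprod Psi) := range (fun a : A => cp_monom Psi a 0).

Arguments base_alg {K A} Psi.

(* Main.v *)
Require Import Defs.
From mathcomp Require Import ssralg.
From mathcomp Require Import classical_sets reals complex.
From mathcomp Require Import all_boot ssrint finmap boolp.

Import GRing.Theory.
Local Open Scope ring_scope.
Local Open Scope classical_set_scope.

(** Among the non-zero elements of a two-sided ideal, the support can be shrunk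
    until the commutant is reached.  Suppose that [f] in the ideal does not
    commute with some [a] in [A].  Then some coefficient [f_n] satisfies
    [f_n Psi^n(a) <> a f_n], so [f_n] does not annihilate all of [A]; this is
    what replaces a unit.  Right multiplication by a suitable [b delta^(-n)]
    moves this coefficient to degree 0 without killing it ([shift_to_degree0])
    and without enlarging the support ([card_finsupp_mul_monom]).
    The resulting [g] has [g_0 <> 0].  If it commutes with [A], it is the
    element sought.  Otherwise [g a - a g] is
    non-zero for some [a]; its support lies in that of [g], and its coefficient
    in degree 0 vanishes because [A] is commutative and [Psi^0] is the identity
    ([commutator_finsupp_proper]).  Hence the support has become strictly
    smaller, and induction on its size concludes
    ([ideal_meets_commutant_nonzero]). *)

Section IdealsMeetCommutant.
Variables (K : comNzRingType) (A : comNUAlgType K) (Psi : algAut A).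
Local Notation CP := (crossprod Psi).
Implicit Types (f g : CP) (a b : A) (m n : int).

Lemma cp_coef0 n : cp_coef (0 : CP) n = 0.
Proof. exact: cp_zero_coef. Qed.

Lemma cp_coefB f g n : cp_coef (f - g) n = cp_coef f n - cp_coef g n.
Proof. by rewrite [LHS]cp_add_coef cp_opp_coef. Qed.

Lemma mem_finsupp_coef f n : (n \in finsupp f) = (cp_coef f n != 0).
Proof. exact: mem_finsupp. Qed.

Lemma cp_mul_monom_coef f b m n :
  cp_coef (f ** cp_monom Psi b m) n = cp_coef f (n - m) ** aut_pow Psi (n - m) b.
Proof.
rewrite (@cp_mul_coef_sub _ _ _ ((n - m) |` finsupp f)%fset) ?fsubsetUr //.
rewrite (big_fsetD1 (n - m)) ?fset1U1 //= big_seq big1 => [|k].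
  by rewrite addr0 cp_monom_coef subKr eqxx.
rewrite !inE => /andP[knm _]; rewrite cp_monom_coef.
case: eqP => [nk|_]; last by rewrite linear0 amulr0.
by rewrite -nk subKr eqxx in knm.
Qed.

Lemma cp_base_mul_coef a f n :
  cp_coef (cp_monom Psi a 0 ** f) n = a ** cp_coef f n.
Proof.
rewrite (@cp_mul_coef_sub _ _ _ [fset 0]%fset).
  by rewrite big_seq_fset1 cp_monom_coef eqxx subr0.
apply/fsubsetP => k; rewrite mem_finsupp_coef cp_monom_coef inE.
by case: (k == 0) => //; rewrite eqxx.
Qed.

Lemma cp_mul_base_coef f a n :
  cp_coef (f ** cp_monom Psi a 0) n = cp_coef f n ** aut_pow Psi n a.
Proof. by rewrite cp_mul_monom_coef subr0. Qed.

Lemma not_commutant_base f : ~ commutant (base_alg Psi) f ->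
  exists a, f ** cp_monom Psi a 0 <> cp_monom Psi a 0 ** f.
Proof.
move=> nf; apply: contrapT => /forallNP comm.
by apply: nf => _ [a _ <-]; apply: contrapT; apply: comm.
Qed.

(** A coefficient that annihilates [A] commutes with everything, so an element
    outside the commutant has a coefficient that survives multiplication by a
    monomial; the monomial is chosen of opposite degree. *)
Lemma shift_to_degree0 f : ~ commutant (base_alg Psi) f ->
  exists b n, cp_coef (f ** cp_monom Psi b n) 0 != 0.
Proof.
move=> /not_commutant_base[a]; apply: contra_notP => /forallNP f0.
have fn0 b n : cp_coef f n ** aut_pow Psi n b = 0.
  have /forallNP/(_ (- n))/negP := f0 b.
  by rewrite negbK cp_mul_monom_coef opprK add0r => /eqP.
apply/cp_coefP => n; rewrite cp_mul_base_coef cp_base_mul_coef fn0 amulC.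
have -> : a = aut_pow Psi n (aut_pow Psi (- n) a) by rewrite -aut_powD subrr.
by rewrite fn0.
Qed.

Lemma card_finsupp_mul_monom f b m :
  (#|` finsupp (f ** cp_monom Psi b m)| <= #|` finsupp f|)%N.
Proof.
have sub_shift : (finsupp (f ** cp_monom Psi b m)
    `<=` [fset (k + m)%R | k in finsupp f])%fset.
  apply/fsubsetP => n; rewrite mem_finsupp_coef cp_mul_monom_coef => fn0.
  apply/imfsetP; exists (n - m); last by rewrite subrK.
  rewrite /= mem_finsupp_coef.
  by apply: contraNneq fn0 => ->; rewrite amul0r.
exact: leq_trans (fsubset_leq_card sub_shift) (leq_imfset_card _ _ _).
Qed.

(** In degree 0 the product is the untwisted one of [A], so the commutator with
    an element of [A] loses the coefficient of degree 0. *)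
Lemma commutator_finsupp_proper f a : cp_coef f 0 != 0 ->
  (finsupp (f ** cp_monom Psi a 0 - cp_monom Psi a 0 ** f : CP)
     `<` finsupp f)%fset.
Proof.
set h : CP := _ - _ => f0; have hE n :
    cp_coef h n = cp_coef f n ** aut_pow Psi n a - a ** cp_coef f n.
  by rewrite cp_coefB cp_mul_base_coef cp_base_mul_coef.
have sub_hf : (finsupp h `<=` finsupp f)%fset.
  apply/fsubsetP => n; rewrite !mem_finsupp_coef hE.
  by apply: contraNneq => ->; rewrite amul0r amulr0 subrr.
rewrite fproperEneq sub_hf andbT; apply: contraNneq f0 => hf.
apply/eqP/cp_dflt; rewrite -hf mem_finsupp_coef negbK hE.
by rewrite amulC subrr.
Qed.

Lemma ideal_meets_commutant_nonzero (I : set CP) : two_sided_ideal I ->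
  forall f, I f -> f <> 0 ->
  exists g, [/\ I g, commutant (base_alg Psi) g & g <> 0].
Proof.
move=> idI f; have [N] := ubnP #|` finsupp f|.
elim: N f => // N IH f ltfN If fn0.
have [cf|/shift_to_degree0[b [n]]] := pselect (commutant (base_alg Psi) f).
  by exists f.
set g := f ** _ => g0.
have Ig : I g by apply: idealMr.
have [cg|/not_commutant_base[a nga]] := pselect (commutant (base_alg Psi) g).
  by exists g; split=> // gE; rewrite gE cp_coef0 eqxx in g0.
apply: (IH (g ** cp_monom Psi a 0 - cp_monom Psi a 0 ** g)).
- apply: leq_trans (fproper_ltn_card (commutator_finsupp_proper _ _ g0)) _.
  exact: leq_trans (card_finsupp_mul_monom _ _ _) ltfN.
- apply: idealD => //; first exact: idealMr.
  by rewrite -scaleN1r; apply: idealZ => //; apply: idealMl.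
- by move/subr0_eq.
Qed.

End IdealsMeetCommutant.

Theorem theorem3p1 (R : realType) (A : comNUAlgType R[i]) (Psi : algAut A)
    (I : set (crossprod Psi)) :
  two_sided_ideal I -> I <> [set 0] ->
  I `&` commutant (base_alg Psi) <> [set 0].
Proof.
move=> idI In0 IC0.
have [f If fn0] : exists2 f, I f & f <> 0.
  apply: contrapT => noI; apply: In0; apply/seteqP; split=> [f If|_ ->].
    by apply: contrapT => fn0; apply: noI; exists f.
  exact: ideal0.
have [g [Ig cg gn0]] := ideal_meets_commutant_nonzero _ _ _ _ idI f If fn0.
by apply: gn0; have : [set 0] g by rewrite -IC0.
Qed.
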